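(* Any bounded group of $J$-unitary operators in a real Pontryagin space $\Pi_k$ has an invariant dual pair of subspaces.
   Context: A real Pontryagin space $\Pi_k$ ($k$ a non-negative integer) is the space $\mathcal{H}=H\oplus K$, where $H$ and $K$ are real Hilbert spaces with $\dim H=\infty$, $\dim K=k$, equipped with the indefinite scalar product $[x,y]=(P_Hx,y)-(P_Kx,y)$, where $P_H,P_K$ are the projections onto the summands. A (bounded, invertible) operator $U$ on $\mathcal{H}$ is $J$-unitary if $[Ux,Uy]=[x,y]$ for all $x,y\in\mathcal{H}$. A group $\Gamma$ of such operators is bounded if $\sup_{U\in\Gamma}\|U\|<\infty$. A subspace is positive (negative) if $[x,x]>0$ (respectively $[x,x]<0$) for all its non-zero elements $x$. Subspaces $M,N$ of $\mathcal{H}$ form a dual pair of subspaces if $M$ is positive, $N$ is negative and $M+N=\mathcal{H}$; the pair is invariant for $\Gamma$ if both $M$ and $N$ are invariant under all $U\in\Gamma$. *)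

(* Defs.v *)
From HB Require Import structures.
From mathcomp Require Import all_boot all_order all_algebra.
From mathcomp Require Import all_classical all_reals all_analysis.

Set Implicit Arguments.
Unset Strict Implicit.
Unset Printing Implicit Defensive.

Import Order.TTheory GRing.Theory Num.Theory.
Import numFieldNormedType.Exports.

Local Open Scope classical_set_scope.
Local Open Scope ring_scope.

(* {dot V for idfun} is the type of symmetric positive definite bilinear
   forms on V. *)
HB.mixin Record isHilbert (R : realType) V of CompleteNormedModule R V := {
  hdot : {dot V for idfun} ;
  normr_hdot : forall x : V, `|x| ^+ 2 = hdot x x }.

#[short(type="hilbertType")]
HB.structure Definition Hilbert (R : realType) :=
  {V of isHilbert R V & CompleteNormedModule R V}.

Definition has_dim (R : realType) (V : lmodType R) (n : nat) : Prop :=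
  exists e : 'I_n -> V,
    forall v : V, exists! c : 'rV[R]_n, v = \sum_i c 0 i *: e i.

Definition infinite_dim (R : realType) (V : lmodType R) : Prop :=
  forall n : nat, ~ has_dim V n.

Section Pontryagin.
Context (R : realType) (H K : hilbertType R).

(* The library norm on H * K is the max norm; it induces the same topology as
   sum_norm, the norm of the Hilbert sum of H and K. *)
Definition sum_dot (x y : H * K) : R := hdot x.1 y.1 + hdot x.2 y.2.
Definition sum_norm (x : H * K) : R := Num.sqrt (sum_dot x x).

Definition proj_H (x : H * K) : H * K := (x.1, 0).
Definition proj_K (x : H * K) : H * K := (0, x.2).

Definition indef_dot (x y : H * K) : R :=
  sum_dot (proj_H x) y - sum_dot (proj_K x) y.

Definition opnorm (T : H * K -> H * K) : \bar R :=
  ereal_sup [set (sum_norm (T x))%:E | x in [set x | sum_norm x <= 1]].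

Definition bounded_operator (T : H * K -> H * K) : Prop :=
  linear T /\ (opnorm T < +oo)%E.

Definition J_unitary (U : H * K -> H * K) : Prop :=
  [/\ bounded_operator U,
      exists V, [/\ bounded_operator V, cancel U V & cancel V U]
    & forall x y, indef_dot (U x) (U y) = indef_dot x y].

Definition operator_group (G : set (H * K -> H * K)) : Prop :=
  [/\ G id,
      forall U V, G U -> G V -> G (U \o V)
    & forall U, G U -> exists V, [/\ G V, cancel U V & cancel V U]].

Definition bounded_family (G : set (H * K -> H * K)) : Prop :=
  (ereal_sup [set opnorm U | U in G] < +oo)%E.

(* As usual for Hilbert spaces, subspaces are closed linear subspaces. *)
Definition closed_subspace (M : set (H * K)) : Prop :=
  [/\ M 0, forall (a : R) x y, M x -> M y -> M (a *: x + y) & closed M].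

Definition positive_set (M : set (H * K)) : Prop :=
  forall x, M x -> x != 0 -> 0 < indef_dot x x.

Definition negative_set (M : set (H * K)) : Prop :=
  forall x, M x -> x != 0 -> indef_dot x x < 0.

Definition dual_pair (M N : set (H * K)) : Prop :=
  [/\ closed_subspace M, closed_subspace N, positive_set M, negative_set N
    & [set x + y | x in M & y in N] = setT].

Definition invariant_under (G : set (H * K -> H * K)) (M : set (H * K)) : Prop :=
  forall U, G U -> U @` M `<=` M.

End Pontryagin.

(* Main.v *)
From HB Require Import structures.
Require Import Defs.
From mathcomp Require Import all_boot all_order all_algebra.
From mathcomp Require Import all_classical all_reals all_analysis.
From mathcomp Require Import ring lra.

Set Implicit Arguments.
Unset Strict Implicit.
Unset Printing Implicit Defensive.

Import Order.TTheory GRing.Theory Num.Theory.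
Import numFieldNormedType.Exports.

(** The negative subspace is found as the unique minimiser of a strictly convex
    function on the maximal negative subspaces; uniqueness makes it invariant.

    Fix an orthonormal basis [e] of [K].  A maximal negative subspace is the
    graph [L] of a strict contraction [A] from [K] to [H], which is recorded by
    the vectors [a i = A (e i)].  Let [Q_L] be the J-orthogonal projection onto
    [L], and consider
      F(L) = sup over U in G of the sum over j of - J[Q_L n_j, Q_L n_j],
    where [n_j = U (0, e j)] is the image of the basis of the second summand.
    Since [Q_(h L) (h x) = h (Q_L x)], this [F] is invariant under [G]; it is
    finite at [A = 0] because [G] is bounded.

    Strict convexity in [A] comes from the variational formula
      - J[Q_L n, Q_L n] = sup over l in L of J[l, l] - 2 J[l, n].
    With [l = (A v, v)] the bracket equals [|A v|^2 - 2 <A v, n.1>] plus terms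
    that do not depend on [A], so that for each fixed [v] it is a convex
    quadratic function of [A], and at the midpoint of [A] and [B] it lies below
    the average by [|(A - B) v|^2 / 4].  The vectors [v = w_j] at which the
    supremum is attained for [n_j] satisfy [|u|^2 <= \sum_j <u, w_j>^2] for all
    [u], because the [n_j] span a maximal negative subspace
    ([projection_frame]).  Hence the gain is at least [|a i - b i|^2 / 4] for
    every [i], uniformly in [U]: see [energy_bound_midpoint].

    By this uniform convexity a minimising sequence is Cauchy, and [F] is lower
    semicontinuous as a supremum of continuous functions, so the minimum is
    attained ([energy_minimizer]), at one point only.  Finiteness of the
    supremum already forces the graph to be negative
    ([energy_bound_negative]), so that the limit does not escape to the boundary
    of the ball of contractions.  The minimiser is the required negative
    subspace, and its J-orthogonal complement is the positive one
    ([dual_pair_graph]). *)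

Local Open Scope classical_set_scope.
Local Open Scope ring_scope.

Local Notation "''[' x , y ]" := (hdot x y) : ring_scope.
Local Notation "''J[' x , y ]" := (indef_dot x y) : ring_scope.

(** * Inner products *)

Section HilbertSpace.
Context (R : realType) (V : hilbertType R).
Implicit Types x y z : V.

Lemma hdotC x y : '[x, y] = '[y, x].
Proof. by rewrite hermC expr0 mul1r. Qed.

Lemma hdotDl x y z : '[x + y, z] = '[x, z] + '[y, z].
Proof. exact: linearDl. Qed.

Lemma hdotBl x y z : '[x - y, z] = '[x, z] - '[y, z].
Proof. exact: linearBl. Qed.

Lemma hdotZl (a : R) x y : '[a *: x, y] = a * '[x, y].
Proof. exact: linearZl_LR. Qed.

Lemma hdotDr x y z : '[x, y + z] = '[x, y] + '[x, z].
Proof. exact: linearDr. Qed.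

Lemma hdotZr (a : R) x y : '[x, a *: y] = a * '[x, y].
Proof. exact: linearZr_LR. Qed.

Lemma hdot0l x : '[0, x] = 0.
Proof. exact: linear0l. Qed.

Lemma hdot0r x : '[x, 0] = 0.
Proof. exact: linear0r. Qed.

Lemma hdot_suml I (r : seq I) (F : I -> V) y :
  '[\sum_(i <- r) F i, y] = \sum_(i <- r) '[F i, y].
Proof. exact: linear_sumlz. Qed.

Lemma hdot_sumr I (r : seq I) (F : I -> V) y :
  '[y, \sum_(i <- r) F i] = \sum_(i <- r) '[y, F i].
Proof. exact: linear_sumr. Qed.

Lemma hdotNl x y : '[- x, y] = - '[x, y].
Proof. exact: linearNl. Qed.

Lemma hdotNr x y : '[x, - y] = - '[x, y].
Proof. exact: linearNr. Qed.

Definition hdotE := (hdotDl, hdotNl, hdotZl, hdotDr, hdotNr, hdotZr).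

Lemma hdot_ge0 x : 0 <= '[x, x].
Proof. by rewrite -normr_hdot exprn_ge0. Qed.

Lemma hdot_eq0 x : ('[x, x] == 0) = (x == 0).
Proof. by rewrite -normr_hdot expf_eq0 /= normr_eq0. Qed.

Lemma hdot_gt0 x : x != 0 -> 0 < '[x, x].
Proof. by move=> x0; rewrite lt0r hdot_eq0 x0 hdot_ge0. Qed.

Lemma cauchy_schwarz x y : '[x, y] ^+ 2 <= '[x, x] * '[y, y].
Proof.
have [->|/hdot_gt0 y0] := eqVneq y 0; first by rewrite !hdot0r expr2 !mulr0.
have := hdot_ge0 ('[y, y] *: x - '[x, y] *: y).
have -> : '['[y, y] *: x - '[x, y] *: y, '[y, y] *: x - '[x, y] *: y] =
   '[y, y] * ('[x, x] * '[y, y] - '[x, y] ^+ 2).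
  by rewrite !hdotE (hdotC y x); ring.
by rewrite pmulr_rge0// subr_ge0.
Qed.

Lemma hdot_continuous y : continuous (fun x => '[x, y]).
Proof.
have -> : (fun x => '[x, y]) =
    (fun x => 4^-1 * (`|x + y| ^+ 2 - `|x - y| ^+ 2)).
  by apply/funext => x; rewrite !normr_hdot !hdotE (hdotC y x); field.
move=> x; apply: cvgMr; apply: cvgB.
  by apply: cvgM; apply: cvg_norm; apply: cvgD => //; exact: cvg_cst.
by apply: cvgM; apply: cvg_norm; apply: cvgB => //; exact: cvg_cst.
Qed.

End HilbertSpace.

(** * Orthonormal bases *)

Section OrthonormalBasis.
Context (R : realType) (K : hilbertType R).

Definition orthonormal_family m (e : 'I_m -> K) :=
  forall i j, '[e i, e j] = (i == j)%:R.

(** The coordinates of the [e i] form a matrix that has the matrix of inner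
    products with [e] as a right inverse. *)
Lemma orthonormal_size k m (e : 'I_m -> K) :
  has_dim K k -> orthonormal_family e -> (m <= k)%N.
Proof.
move=> [f fP] eP.
pose c v := projT1 (cid (fP v)).
have cP v : v = \sum_i c v 0 i *: f i by have [] := projT2 (cid (fP v)).
pose A : 'M[R]_(m, k) := \matrix_(i, j) c (e i) 0 j.
suff : row_free A by rewrite -row_leq_rank => /leq_trans; apply; exact: rank_leq_col.
apply/row_freeP; exists (\matrix_(j, i) '[f j, e i]).
apply/matrixP => i j; rewrite !mxE -eP [in RHS](cP (e i)) hdot_suml.
by apply: eq_bigr => l _; rewrite !mxE hdotZl.
Qed.

(** An orthonormal family of maximal size spans: otherwise the normalised
    component of some vector orthogonal to the family would extend it. *)
Lemma orthonormal_basis k : has_dim K k ->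
  exists m (e : 'I_m -> K), orthonormal_family e /\
    forall x, x = \sum_i '[x, e i] *: e i.
Proof.
move=> dimK.
pose P m := `[< exists e : 'I_m -> K, orthonormal_family e >].
have exP : exists m, P m.
  by exists 0%N; apply/asboolP; exists (fun _ => 0) => -[].
have ubP m : P m -> (m <= k)%N.
  by move=> /asboolP[e]; exact: orthonormal_size.
have [m /asboolP[e eP] mmax] := ex_maxnP exP ubP.
exists m, e; split=> // x.
apply/eqP; rewrite -subr_eq0; apply/negPn/negP.
set d := x - _ => d0.
have de i : '[d, e i] = 0.
  rewrite hdotBl hdot_suml (bigD1 i)//= big1 ?addr0 => [|j ji].
    by rewrite hdotZl eP eqxx mulr1 subrr.
  by rewrite hdotZl eP (negPf ji) mulr0.
pose u := `|d|^-1 *: d.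
have nd : `|d| != 0 by rewrite normr_eq0.
have uu : '[u, u] = 1.
  by rewrite hdotZl hdotZr -normr_hdot expr2 mulKf ?mulVf.
have ue i : '[u, e i] = 0 by rewrite hdotZl de mulr0.
pose e' (i : 'I_m.+1) := oapp e u (unlift ord0 i).
suff : P m.+1 by move=> /mmax; rewrite ltnn.
apply/asboolP; exists e' => i j; rewrite /e'.
case: (unliftP ord0 i) => [i'|] ->; case: (unliftP ord0 j) => [j'|] -> /=.
- by rewrite eP (inj_eq lift_inj).
- by rewrite hdotC ue.
- by rewrite ue.
- by rewrite uu.
Qed.

End OrthonormalBasis.

(** * Linear algebra in an orthonormal basis *)

Lemma linear_apply_sum (R : realType) (U V : lmodType R) (f : U -> V) : linear f ->
  forall n (c : 'I_n -> R) (x : 'I_n -> U),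
  f (\sum_i c i *: x i) = \sum_i c i *: f (x i).
Proof.
move=> lf n c x.
pose g : {linear U -> V} := HB.pack f (GRing.isLinear.Build R U V *:%R f lf).
by rewrite -[f]/(g : U -> V) linear_sum; apply: eq_bigr => i _; rewrite linearZ.
Qed.

Section FiniteDimension.
Context (R : realType) (K : hilbertType R) (m : nat) (e : 'I_m -> K).
Context (eP : orthonormal_family e).
Context (eS : forall x, x = \sum_i '[x, e i] *: e i).

Lemma coord_basis (c : 'I_m -> R) j : '[\sum_i c i *: e i, e j] = c j.
Proof.
rewrite hdot_suml (bigD1 j)//= big1 ?addr0 => [|i ij].
  by rewrite hdotZl eP eqxx mulr1.
by rewrite hdotZl eP (negPf ij) mulr0.
Qed.

Lemma parseval x : '[x, x] = \sum_i '[x, e i] ^+ 2.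
Proof.
rewrite [X in '[_, X]](eS x) hdot_sumr.
by apply: eq_bigr => i _; rewrite hdotZr.
Qed.

Lemma basis_ext x y : (forall i, '[x, e i] = '[y, e i]) -> x = y.
Proof.
by move=> xy; rewrite (eS x) (eS y); apply: eq_bigr => i _; rewrite xy.
Qed.

Lemma injective_surjective (T : K -> K) : linear T ->
  (forall x, T x = 0 -> x = 0) -> forall y, exists x, T x = y.
Proof.
move=> lT injT y.
pose A : 'M[R]_m := \matrix_(i, j) '[T (e i), e j].
have TA (v : 'rV[R]_m) j : '[T (\sum_i v 0 i *: e i), e j] = (v *m A) 0 j.
  rewrite linear_apply_sum// hdot_suml mxE.
  by apply: eq_bigr => i _; rewrite hdotZl mxE.
have uA : A \in unitmx.
  rewrite -row_free_unit; apply/inj_row_free => v vA.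
  have Tv : T (\sum_i v 0 i *: e i) = 0.
    by apply: basis_ext => j; rewrite TA vA mxE hdot0l.
  apply/rowP => j; rewrite mxE -(coord_basis (fun i => v 0 i) j).
  by rewrite (injT _ Tv) hdot0l.
pose v : 'rV[R]_m := (\row_j '[y, e j]) *m invmx A.
exists (\sum_i v 0 i *: e i); apply: basis_ext => j.
by rewrite TA mulmxKV// mxE.
Qed.

(** The map [w |-> \sum_i f (e i) w *: e i] represents [f] through the inner
    product; positivity of [f] makes it injective, hence surjective. *)
Lemma riesz (f : K -> K -> R) (phi : K -> R) :
  (forall w, scalar (f ^~ w)) -> (forall v, scalar (f v)) -> scalar phi ->
  (forall v, v != 0 -> 0 < f v v) -> exists w, forall v, f v w = phi v.
Proof.
move=> fl fr lphi fpos.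
have ext (g : K -> R) : scalar g -> forall v, g v = \sum_i '[v, e i] * g (e i).
  move=> lg v; rewrite [in LHS](eS v).
  by rewrite (@linear_apply_sum R K R^o g lg).
pose T w := \sum_i f (e i) w *: e i.
have lT : linear T.
  move=> c x y; apply: basis_ext => j.
  by rewrite hdotDl hdotZl !coord_basis fr.
have injT w : T w = 0 -> w = 0.
  move=> Tw0; apply/eqP/negPn/negP => /fpos.
  rewrite (ext (f^~ w))// big1 ?ltxx// => i _.
  by rewrite -(coord_basis (fun i => f (e i) w)) -/(T w) Tw0 hdot0l mulr0.
have [w Tw] := injective_surjective lT injT (\sum_i phi (e i) *: e i).
exists w => v; rewrite (ext (f^~ w))// [RHS]ext//.
apply: eq_bigr => i _; congr (_ * _).
by rewrite -(coord_basis (fun i => f (e i) w)) -/(T w) Tw coord_basis.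
Qed.

End FiniteDimension.

(** * The indefinite form *)

Section IndefiniteForm.
Context (R : realType) (H K : hilbertType R).
Implicit Types x y z : H * K.

Lemma indef_dotE x y : 'J[x, y] = '[x.1, y.1] - '[x.2, y.2].
Proof. by rewrite /indef_dot /sum_dot /= !hdot0l addr0 add0r. Qed.

Lemma indef_dotC x y : 'J[x, y] = 'J[y, x].
Proof. by rewrite !indef_dotE (hdotC x.1) (hdotC x.2). Qed.

Lemma indef_dotDl x y z : 'J[x + y, z] = 'J[x, z] + 'J[y, z].
Proof. by rewrite !indef_dotE /= !hdotDl; ring. Qed.

Lemma indef_dotZl (c : R) x y : 'J[c *: x, y] = c * 'J[x, y].
Proof. by rewrite !indef_dotE /= !hdotZl; ring. Qed.

Lemma indef_dotBl x y z : 'J[x - y, z] = 'J[x, z] - 'J[y, z].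
Proof. by rewrite -scaleN1r indef_dotDl indef_dotZl mulN1r. Qed.

Lemma indef_dotBr x y z : 'J[z, x - y] = 'J[z, x] - 'J[z, y].
Proof. by rewrite indef_dotC indef_dotBl !(indef_dotC z). Qed.

Lemma indef_dot_linear y : scalar (fun x => 'J[x, y]).
Proof. by move=> c x z; rewrite indef_dotDl indef_dotZl. Qed.

Lemma indef_dot_continuous y : continuous (fun x => 'J[x, y]).
Proof.
have -> : (fun x => 'J[x, y]) = (fun x => '[x.1, y.1] - '[x.2, y.2]).
  by apply/funext => x; exact: indef_dotE.
move=> x; apply: cvgB.
  apply: (@continuous_comp _ _ _ fst (fun u : H => '[u, y.1])).
    exact: cvg_fst.
  exact: hdot_continuous.
apply: (@continuous_comp _ _ _ snd (fun u : K => '[u, y.2])).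
  exact: cvg_snd.
exact: hdot_continuous.
Qed.

End IndefiniteForm.

(** * Maximal negative subspaces as graphs *)

Section Graph.
Context (R : realType) (H K : hilbertType R) (m : nat) (e : 'I_m -> K).
Context (eP : orthonormal_family e) (eS : forall x, x = \sum_i '[x, e i] *: e i).
Implicit Types (a b d : 'I_m -> H) (x u v w : K) (n : H * K).

(** The operator from [K] to [H] that sends each [e i] to [a i]; it is the
    angular operator of the subspace [graph a]. *)
Definition angular a v : H := \sum_i '[v, e i] *: a i.

Definition graph a v : H * K := (angular a v, v).

Definition negative_graph a :=
  forall v, v != 0 -> 'J[graph a v, graph a v] < 0.

Lemma angular_linear a : linear (angular a).
Proof.
move=> c x y; rewrite /angular scaler_sumr -big_split; apply: eq_bigr => i _.
by rewrite hdotDl hdotZl scalerDl scalerA.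
Qed.

Lemma graph_linear a : linear (graph a).
Proof. by move=> c x y; rewrite /graph angular_linear. Qed.

Lemma graphB a x y : graph a (x - y) = graph a x - graph a y.
Proof.
by rewrite -[- y]scaleN1r addrC graph_linear scaleN1r addrC.
Qed.

Lemma graph0 a : graph a 0 = 0.
Proof. by rewrite -(subrr 0) graphB subrr. Qed.

Lemma graphZ a c x : graph a (c *: x) = c *: graph a x.
Proof. by rewrite -[c *: x]addr0 graph_linear graph0 addr0. Qed.

Lemma graph_basis a x : graph a x = \sum_i '[x, e i] *: (a i, e i).
Proof.
rewrite [RHS]surjective_pairing /graph; congr pair.
  by rewrite (big_morph fst (id1 := 0) (op1 := +%R)).
by rewrite (big_morph snd (id1 := 0) (op1 := +%R))// -eS.
Qed.

Lemma angularB a b v :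
  angular (fun i => a i - b i) v = angular a v - angular b v.
Proof. by rewrite /angular -sumrB; apply: eq_bigr => i _; rewrite scalerBr. Qed.

Definition midpoint a b i : H := 2^-1 *: (a i + b i).

Lemma angular_midpoint a b v :
  angular (midpoint a b) v = 2^-1 *: (angular a v + angular b v).
Proof.
rewrite /angular -big_split scaler_sumr /=; apply: eq_bigr => i _.
by rewrite /midpoint -scalerDr !scalerA mulrC.
Qed.

(** For fixed [n] and [l] in a negative subspace, this is maximal at the
    J-orthogonal projection of [n], with value minus the form of that
    projection. *)
Definition trial (l n : H * K) : R := 'J[l, l] - 2 * 'J[l, n].

(** The only nonlinear term in the angular operator is the square of a norm, to
    which the parallelogram law applies. *)
Lemma trial_midpoint a b v n :
  trial (graph (midpoint a b) v) n =
  (trial (graph a v) n + trial (graph b v) n) / 2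
  - '[angular (fun i => a i - b i) v, angular (fun i => a i - b i) v] / 4.
Proof.
rewrite angularB /trial !indef_dotE /= angular_midpoint !hdotE.
by rewrite (hdotC (angular b v) (angular a v)); field.
Qed.

Lemma negative_graph_le0 a v : negative_graph a ->
  'J[graph a v, graph a v] <= 0.
Proof.
move=> nega; have [->|/nega/ltW//] := eqVneq v 0.
by rewrite graph0 indef_dotE !hdot0l subrr.
Qed.

Lemma graph_riesz a (phi : K -> R) : negative_graph a -> scalar phi ->
  exists w, forall v, 'J[graph a v, graph a w] = phi v.
Proof.
move=> nega lphi.
have [|||v|w wP] := riesz eP eS (f := fun v w => - 'J[graph a v, graph a w])
    (phi := fun v => - phi v).
- by move=> w c x y; rewrite graph_linear indef_dot_linear; ring.
- move=> w c x y; rewrite indef_dotC graph_linear indef_dot_linear.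
  by rewrite !(indef_dotC _ (graph a w)); ring.
- by move=> c x y; rewrite lphi; ring.
- by rewrite oppr_gt0; exact: nega.
by exists w => v; apply: oppr_inj.
Qed.

Lemma graph_projection a n : negative_graph a ->
  exists w, forall v, 'J[graph a v, graph a w] = 'J[graph a v, n].
Proof.
move=> nega; apply: (graph_riesz (phi := fun v => 'J[graph a v, n])) => //.
by move=> c x y; rewrite graph_linear indef_dot_linear.
Qed.

(** The difference of both sides is the form at [graph a (v - w)]. *)
Lemma trial_max a n w v : negative_graph a ->
  (forall u, 'J[graph a u, graph a w] = 'J[graph a u, n]) ->
  trial (graph a v) n <= trial (graph a w) n.
Proof.
move=> nega wP; have := negative_graph_le0 (v - w) nega.
rewrite graphB indef_dotBl !indef_dotBr (indef_dotC (graph a w) (graph a v)).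
by rewrite /trial -!wP; lra.
Qed.

(** In terms of the positive definite form [f u v = - J[graph a u, graph a v]]
    on [K], which lies below the inner product, represent the functional
    [<., u>] as [f . v].  Then [<u, w j> = f (w j) v = - J[graph a v, n j]], and
    the hypothesis on [n] bounds the sum of squares below by [f v v].  Finally
    [f v v = <v, u> >= <u, u>], since [f (v - u) (v - u) >= 0] and
    [f u u <= <u, u>]. *)
Lemma projection_frame a (n : 'I_m -> H * K) (w : 'I_m -> K) :
  negative_graph a ->
  (forall x : H * K, - 'J[x, x] <= \sum_j 'J[x, n j] ^+ 2) ->
  (forall j v, 'J[graph a v, graph a (w j)] = 'J[graph a v, n j]) ->
  forall u, '[u, u] <= \sum_j '[u, w j] ^+ 2.
Proof.
move=> nega nframe wP u.
have [|v vP] := graph_riesz (phi := fun x => - '[x, u]) nega.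
  by move=> c x y; rewrite hdotDl hdotZl; ring.
have -> : \sum_j '[u, w j] ^+ 2 = \sum_j 'J[graph a v, n j] ^+ 2.
  apply: eq_bigr => j _.
  by rewrite -wP indef_dotC vP sqrrN hdotC.
apply: le_trans (nframe _); rewrite vP opprK.
have := negative_graph_le0 (v - u) nega.
rewrite graphB indef_dotBl !indef_dotBr (indef_dotC (graph a v) (graph a u)).
rewrite !vP indef_dotE /=.
have := hdot_ge0 (angular a u); lra.
Qed.

(** Apply the frame inequality to the image [u] of [d i] under the adjoint of
    [angular d], whose norm is at least [<d i, d i>], then the Cauchy-Schwarz
    inequality to each [<angular d (w j), d i>]. *)
Lemma frame_spread d (w : 'I_m -> K) i :
  (forall u, '[u, u] <= \sum_j '[u, w j] ^+ 2) ->
  '[d i, d i] <= \sum_j '[angular d (w j), angular d (w j)].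
Proof.
move=> wframe; set s := \sum_j _.
have s0 : 0 <= s by apply: sumr_ge0 => j _; exact: hdot_ge0.
have [->|/hdot_gt0 d0] := eqVneq (d i) 0; first by rewrite hdot0l.
rewrite -(ler_pM2l d0).
pose u := \sum_k '[d k, d i] *: e k.
have uw j : '[u, w j] = '[angular d (w j), d i].
  rewrite !hdot_suml; apply: eq_bigr => k _.
  by rewrite !hdotZl (hdotC (e k)) mulrC.
have uu : '[d i, d i] * '[d i, d i] <= '[u, u].
  rewrite (parseval eS u) (bigD1 i)//= coord_basis// -expr2 lerDl.
  by apply: sumr_ge0 => j _; exact: sqr_ge0.
apply: (le_trans uu); apply: (le_trans (wframe u)).
rewrite mulr_sumr; apply: ler_sum => j _.
by rewrite uw mulrC cauchy_schwarz.
Qed.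

End Graph.

(** * The convex energy and its minimiser *)

Section InvariantGraph.
Context (R : realType) (H K : hilbertType R) (m : nat) (e : 'I_m -> K).
Context (eP : orthonormal_family e) (eS : forall x, x = \sum_i '[x, e i] *: e i).
Context (G : set (H * K -> H * K)) (Ggroup : operator_group G).
Context (GJ : forall U, G U -> J_unitary U).
Implicit Types (a b : 'I_m -> H) (c : R) (u v : K) (w : 'I_m -> K).

Local Notation angular := (angular e).
Local Notation graph := (graph e).
Local Notation negative_graph := (negative_graph e).

Definition frame (U : H * K -> H * K) j : H * K := U (0, e j).

(** The supremum over [w] and over [U] in the group of this quantity is the
    function [F] that is minimised. *)
Definition energy (U : H * K -> H * K) a w : R :=
  \sum_j trial (graph a (w j)) (frame U j).

(** That [c] is an upper bound of [F] at [graph a]; stating bounds instead of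
    values avoids the value [+oo], which [F] takes at the graphs that are not
    negative. *)
Definition energy_bound a c := forall U, G U -> forall w, energy U a w <= c.

Lemma group_linear U : G U -> linear U.
Proof. by move=> /GJ[[]]. Qed.

Lemma group_indef_dot U x y : G U -> 'J[U x, U y] = 'J[x, y].
Proof. by move=> /GJ[_ _ ->]. Qed.

(** For [U] the identity this is Parseval's identity in [K] and the positivity
    of the form on [H]; the general case follows as [U] preserves the form. *)
Lemma frame_parseval U (x : H * K) : G U ->
  - 'J[x, x] <= \sum_j 'J[x, frame U j] ^+ 2.
Proof.
move=> GU; have [V [_ VU UV]] : exists V, [/\ G V, cancel U V & cancel V U].
  by case: Ggroup => _ _; exact.
rewrite -(UV x) group_indef_dot// indef_dotE.
have -> : \sum_j 'J[U (V x), frame U j] ^+ 2 = '[(V x).2, (V x).2].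
  rewrite (parseval eS (V x).2); apply: eq_bigr => j _.
  by rewrite group_indef_dot// indef_dotE /= hdot0r sub0r sqrrN.
by have := hdot_ge0 (V x).1; lra.
Qed.

Lemma energy_bound_ge0 a c : energy_bound a c -> 0 <= c.
Proof.
have [Gid _ _] := Ggroup; move=> /(_ _ Gid (fun=> 0)).
rewrite /energy big1// => j _.
by rewrite graph0 /trial !indef_dotE /= !hdot0l; ring.
Qed.

(** On a vector [graph a v] where the form is nonnegative, [trial] at multiples
    of [v] dominates an affine function, which is not constant for at least one
    vector of the basis, and so is unbounded. *)
Lemma energy_bound_negative a c : energy_bound a c -> negative_graph a.
Proof.
move=> ac v v0; rewrite ltNge; apply/negP => J0.
have [i vi] : exists i, '[v, e i] != 0.
  apply/existsP; apply: contraNT v0; rewrite negb_exists => /forallP v0.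
  apply/eqP; apply: (basis_ext eS) => i; rewrite hdot0l.
  by apply/eqP; have := v0 i; rewrite negbK.
have c0 := energy_bound_ge0 ac; have [Gid _ _] := Ggroup.
(* This [t] makes the affine function equal to [c + 1]. *)
pose t := (c + 1) / (2 * '[v, e i]).
have := ac _ Gid (fun j => if j == i then t *: v else 0).
rewrite /energy (bigD1 i)//= eqxx big1 => [|j /negPf ->]; last first.
  by rewrite graph0 /trial !indef_dotE /= !hdot0l; ring.
rewrite addr0 graphZ /trial indef_dotZl indef_dotC indef_dotZl.
rewrite indef_dotZl (indef_dotE _ (frame _ _)) /= hdot0r.
have -> : 2 * (t * (0 - '[v, e i])) = - (c + 1) by rewrite /t; field.
rewrite mulrA -expr2; have := mulr_ge0 (sqr_ge0 t) J0; lra.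
Qed.

Lemma energy_bound_le a c c' : c <= c' -> energy_bound a c -> energy_bound a c'.
Proof. by move=> cc' ac U GU w; apply: (le_trans (ac U GU w)). Qed.

Lemma energy_midpoint U a b w : energy U (midpoint a b) w =
  (energy U a w + energy U b w) / 2 -
  (\sum_j '[angular (fun i => a i - b i) (w j),
            angular (fun i => a i - b i) (w j)]) / 4.
Proof.
rewrite /energy -big_split /= !mulr_suml -sumrB.
by apply: eq_bigr => j _; exact: trial_midpoint.
Qed.

(** Uniform convexity.  It suffices to bound the energy at the maximising [w'],
    where the gain of [energy_midpoint] is large by [frame_spread]; these
    maximisers exist because the midpoint is itself negative, which already
    follows from plain convexity. *)
Lemma energy_bound_midpoint a b c i : energy_bound a c -> energy_bound b c ->
  energy_bound (midpoint a b) (c - '[a i - b i, a i - b i] / 4).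
Proof.
move=> ac bc.
have neg : negative_graph (midpoint a b).
  apply: (@energy_bound_negative _ c) => U GU w; rewrite energy_midpoint.
  have := ac U GU w; have := bc U GU w.
  set s := \sum_j _; have : 0 <= s by apply: sumr_ge0 => j _; exact: hdot_ge0.
  lra.
move=> U GU w.
pose w' j := projT1 (cid (graph_projection eP eS (frame U j) neg)).
have w'P j : forall v, 'J[graph (midpoint a b) v, graph (midpoint a b) (w' j)] =
    'J[graph (midpoint a b) v, frame U j].
  exact: (projT2 (cid (graph_projection eP eS (frame U j) neg))).
have le_ww' : energy U (midpoint a b) w <= energy U (midpoint a b) w'.
  by apply: ler_sum => j _; exact: trial_max.
apply: (le_trans le_ww'); rewrite energy_midpoint.
have w'frame := projection_frame eP eS neg (fun x => frame_parseval x GU) w'P.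
have := frame_spread eP eS (fun i => a i - b i) i w'frame.
have := ac U GU w'; have := bc U GU w'; lra.
Qed.

Lemma angular_cvg (a_ : nat -> 'I_m -> H) a v :
  (forall i, a_ ^~ i @ \oo --> a i) -> angular (a_ n) v @[n --> \oo] --> angular a v.
Proof.
move=> a_a; rewrite /angular.
apply: (cvg_big (op := +%R)) => [|i _]; first exact: add_continuous.
by apply: cvgZr; exact: a_a.
Qed.

Lemma energy_cvg (a_ : nat -> 'I_m -> H) a U w :
  (forall i, a_ ^~ i @ \oo --> a i) ->
  energy U (a_ n) w @[n --> \oo] --> energy U a w.
Proof.
move=> a_a; rewrite /energy.
apply: (cvg_big (op := +%R)) => [|j _]; first exact: add_continuous.
have aw := @angular_cvg _ _ (w j) a_a.
have -> : (fun n => trial (graph (a_ n) (w j)) (frame U j)) = (fun n =>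
    (`|angular (a_ n) (w j)| ^+ 2 - '[w j, w j]) -
    2 * ('[angular (a_ n) (w j), (frame U j).1] - '[w j, (frame U j).2])).
  by apply/funext => n; rewrite /trial !indef_dotE /= (normr_hdot (angular _ _)).
rewrite /trial !indef_dotE /= -(normr_hdot (angular a (w j))).
apply: cvgB.
  apply: cvgB; last exact: cvg_cst.
  by apply: cvgM; apply: cvg_norm.
apply: cvgMr; apply: cvgB; last exact: cvg_cst.
by apply: (cvg_comp _ (fun x => '[x, (frame U j).1]) aw); exact: hdot_continuous.
Qed.

(** The midpoint of two almost minimising families cannot lie below the
    infimum, so uniform convexity forces them to be close. *)
Lemma energy_minimizer a0 c0 : energy_bound a0 c0 ->
  exists a c, energy_bound a c /\ forall b c', energy_bound b c' -> c <= c'.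
Proof.
move=> a0c0; pose C := [set c | exists a, energy_bound a c].
have infC : has_inf C.
  split; first by exists c0, a0.
  by exists 0 => c [a]; exact: energy_bound_ge0.
have leC b c' : energy_bound b c' -> inf C <= c'.
  by move=> bc'; apply: ge_inf; [exact: infC.2 | exists b].
have ex_a n : exists a, energy_bound a (inf C + n.+1%:R^-1).
  have [|c [a ac] /ltW cC] := inf_adherent _ infC (eps := n.+1%:R^-1).
    by rewrite invr_gt0.
  by exists a; exact: energy_bound_le ac.
pose a_ n := projT1 (cid (ex_a n)).
have a_P n : energy_bound (a_ n) (inf C + n.+1%:R^-1) := projT2 (cid (ex_a n)).
have a_dist N n i : (N <= n)%N -> `|a_ N i - a_ n i| ^+ 2 <= 4 * N.+1%:R^-1.
  move=> Nn; have nN : energy_bound (a_ n) (inf C + N.+1%:R^-1).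
    apply: energy_bound_le (a_P n).
    by rewrite lerD2l lef_pV2 ?posrE// ler_nat.
  have := leC _ _ (energy_bound_midpoint i (a_P N) nN).
  by rewrite normr_hdot; move: (N.+1%:R^-1) => q; lra.
have a_cvg i : cvg (a_ ^~ i @ \oo).
  apply: cauchy_cvg; apply: cauchy_exP => eps eps0.
  have eps4 : 0 < eps ^+ 2 / 4 by rewrite divr_gt0// exprn_gt0.
  have [N _ NP] := near_infty_natSinv_lt (PosNum eps4).
  exists (a_ N i); exists N => // n /= Nn; rewrite -ball_normE /=.
  rewrite -(@ltr_pXn2r _ 2)// ?nnegrE ?normr_ge0 ?(ltW eps0)//.
  apply: (le_lt_trans (a_dist N n i Nn)).
  by have := NP N (leqnn _) => /=; move: (N.+1%:R^-1) => q; lra.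
pose al i : H := lim (a_ ^~ i @ \oo).
exists al, (inf C); split; last exact: leC.
move=> U GU w.
have Ccvg : inf C + n.+1%:R^-1 @[n --> \oo] --> inf C.
  by rewrite -[X in _ --> X]addr0; apply: cvgD; [exact: cvg_cst|exact: cvg_harmonic].
have Ecvg : energy U (a_ n) w @[n --> \oo] -->
    energy U al w by exact: energy_cvg.
apply: (ler_cvg_to Ecvg Ccvg).
by apply: nearW => n; exact: a_P.
Qed.

(** The translate by [h] of a maximal negative subspace is again a graph, because
    its projection [T] to [K] is injective: a vector with zero component in [K]
    is not negative.  Its energy bound is that of the original subspace, after
    the substitution of [h^-1 U] for [U]. *)
Lemma energy_bound_translate a c h : G h -> energy_bound a c ->
  exists2 b, energy_bound b c & forall v, exists u, graph b v = h (graph a u).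
Proof.
move=> Gh ac; have neg := energy_bound_negative ac.
have [_ Gcomp Ginv] := Ggroup; have lh := group_linear Gh.
pose T v := (h (graph a v)).2.
have lT : linear T by move=> k x y; rewrite /T graph_linear lh.
have injT v : T v = 0 -> v = 0.
  move=> Tv0; apply/eqP/negPn/negP => /neg.
  rewrite -(group_indef_dot _ _ Gh) indef_dotE -/(T v) Tv0 hdot0l subr0 ltNge.
  by rewrite hdot_ge0.
pose t i := projT1 (cid (injective_surjective eP eS lT injT (e i))).
have tP i : T (t i) = e i := projT2 (cid (injective_surjective eP eS lT injT (e i))).
pose b i := (h (graph a (t i))).1.
have bP v : graph b v = h (graph a (\sum_i '[v, e i] *: t i)).
  rewrite linear_apply_sum; last exact: graph_linear.
  rewrite linear_apply_sum// (graph_basis eS); apply: eq_bigr => i _.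
  by rewrite -(tP i) /b /T -surjective_pairing.
exists b; last by move=> v; eexists; exact: bP.
move=> U GU w; have [V [GV hV Vh]] := Ginv _ Gh.
apply: le_trans (ac (V \o U) (Gcomp _ _ GV GU) (fun j => \sum_i '[w j, e i] *: t i)).
apply: ler_sum => j _; rewrite bP /trial group_indef_dot//.
by rewrite -[in leLHS](Vh (frame U j)) group_indef_dot.
Qed.

(** By [energy_bound_midpoint] the minimiser is unique, hence equal to its
    translates. *)
Lemma invariant_graph a0 c0 : energy_bound a0 c0 ->
  exists2 a, negative_graph a & invariant_under G (range (graph a)).
Proof.
move=> /energy_minimizer[a [c [ac cmin]]].
exists a; first exact: energy_bound_negative ac.
move=> h Gh _ [_ [v _ <-] <-]; have [_ _ Ginv] := Ggroup.
have [V [GV hV Vh]] := Ginv _ Gh.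
have [b bc bP] := energy_bound_translate GV ac.
have ab : a = b.
  apply/funext => i; apply/eqP; rewrite -subr_eq0 -hdot_eq0.
  have := cmin _ _ (energy_bound_midpoint i ac bc).
  have := hdot_ge0 (a i - b i) => ge0 le0; apply/eqP; lra.
have [u] := bP v; rewrite -ab => ->.
by exists u => //; rewrite Vh.
Qed.

End InvariantGraph.

(** * The invariant dual pair *)

Section DualPair.
Context (R : realType) (H K : hilbertType R) (m : nat) (e : 'I_m -> K).
Context (eP : orthonormal_family e) (eS : forall x, x = \sum_i '[x, e i] *: e i).
Context (G : set (H * K -> H * K)) (Ggroup : operator_group G).
Context (GJ : forall U, G U -> J_unitary U).
Implicit Types (a : 'I_m -> H) (N : set (H * K)).

Local Notation angular := (angular e).
Local Notation graph := (graph e).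
Local Notation negative_graph := (negative_graph e).

Definition indef_orthogonal (N : set (H * K)) : set (H * K) :=
  [set x | forall y, N y -> 'J[x, y] = 0].

Lemma angular_continuous a : continuous (angular a).
Proof.
move=> v; rewrite /angular.
apply: (cvg_big (op := +%R)) => [|i _]; first exact: add_continuous.
by apply: cvgZl; exact: hdot_continuous.
Qed.

Lemma closed_graph a : closed_subspace (range (graph a)).
Proof.
split.
- by exists 0 => //; exact: graph0.
- by move=> c _ _ [u _ <-] [v _ <-]; exists (c *: u + v) => //; exact: graph_linear.
- have -> : range (graph a) = (fun x => `|x.1 - angular a x.2|) @^-1` [set 0].
    apply/seteqP; split=> [_ [v _ <-]|[x v] /= /normr0_eq0/subr0_eq ->] /=.
      by rewrite subrr normr0.
    by exists v.
  apply: preimage_closed; last exact: closed_eq.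
  move=> x _; apply: cvg_norm; apply: cvgB; first exact: cvg_fst.
  apply: (@continuous_comp _ _ _ snd (angular a)); first exact: cvg_snd.
  exact: angular_continuous.
Qed.

Lemma closed_indef_orthogonal N : closed_subspace (indef_orthogonal N).
Proof.
split.
- by move=> y _; rewrite indef_dotE !hdot0l subrr.
- by move=> c x y xN yN z Nz; rewrite indef_dot_linear xN// yN// mulr0 addr0.
- have -> : indef_orthogonal N =
      \bigcap_(y in N) ((fun x => 'J[x, y]) @^-1` [set 0]) by [].
  apply: closed_bigI => y _; apply: preimage_closed; last exact: closed_eq.
  by move=> x _; exact: indef_dot_continuous.
Qed.

(** For [x = (h, v)] orthogonal to the graph, [x - graph a v] lies in [H], and
    Pythagoras gives [J[x, x] = |h - angular a v|^2 - J[graph a v, graph a v]].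
    The sum is everything because each vector has a projection onto a negative
    graph. *)
Lemma dual_pair_graph a : negative_graph a ->
  dual_pair (indef_orthogonal (range (graph a))) (range (graph a)).
Proof.
move=> neg; split.
- exact: closed_indef_orthogonal.
- exact: closed_graph.
- move=> [h v] xN x0; have xv : 'J[(h, v), graph a v] = 0 by apply: xN; exists v.
  have : 0 < '[h - angular a v, h - angular a v] - 'J[graph a v, graph a v].
    have [v0|/neg] := eqVneq v 0; last by have := hdot_ge0 (h - angular a v); lra.
    have h0 : h != 0 by apply: contraNneq x0 => ->; rewrite v0.
    rewrite v0 graph0 indef_dotE !hdot0l !subr0.
    have -> : angular a 0 = 0 by have [] := graph0 e a.
    by rewrite subr0 hdot_gt0.
  move: xv; rewrite !indef_dotE /= !hdotE (hdotC (angular a v) h); lra.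
- move=> _ [v _ <-] v0; apply: neg; apply: contraNneq v0 => ->.
  by rewrite graph0.
- apply/seteqP; split=> // x _.
  have [w wP] := graph_projection eP eS x neg.
  exists (x - graph a w); last by exists (graph a w); [exists w | rewrite subrK].
  move=> _ [v _ <-]; rewrite indef_dotBl !(indef_dotC _ (graph a v)) wP.
  by rewrite subrr.
Qed.

Lemma invariant_indef_orthogonal N :
  invariant_under G N -> invariant_under G (indef_orthogonal N).
Proof.
move=> invN U GU _ [x xN <-] y Ny.
have [_ _ Ginv] := Ggroup; have [V [GV _ UV]] := Ginv _ GU.
have [_ _ UJ] := GJ GU; rewrite -(UV y) UJ; apply: xN.
by apply: (invN V GV); exists y.
Qed.

(** At the graph of [0] the trial function is [2 <w j, n.2> - |w j|^2] with
    [n = U (0, e j)], which is at most [|n.2|^2]. *)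
Lemma energy_bound0 : bounded_family G -> exists c, energy_bound e G (fun=> 0) c.
Proof.
rewrite /bounded_family => Gbd.
have [C C0 CP] : exists2 C : R, 0 <= C & forall U, G U -> (opnorm U <= C%:E)%E.
  have opC U : G U -> (opnorm U <= ereal_sup [set opnorm U | U in G])%E.
    by move=> GU; apply: ereal_sup_ubound; exists U.
  move: Gbd opC; case: (ereal_sup _) => [C _ opC|//|_ opC].
    exists (Num.max C 0); first by rewrite le_max lexx orbT.
    by move=> U /opC /le_trans; apply; rewrite lee_fin le_max lexx.
  by exists 0 => // U /opC /le_trans; apply; exact: leNye.
have UC U j : G U -> sum_norm (frame e U j) <= C.
  move=> GU; rewrite -lee_fin; apply: le_trans (CP U GU).
  apply: ereal_sup_ubound; exists (0, e j) => //=.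
  by rewrite /sum_norm /sum_dot /= hdot0l eP eqxx add0r sqrtr1.
exists (\sum_(j < m) C ^+ 2) => U GU w; apply: ler_sum => j _.
have angular0 : angular (fun=> 0 : H) (w j) = 0.
  by rewrite /angular big1// => i _; rewrite scaler0.
set n := frame e U j.
have : sum_norm n ^+ 2 <= C ^+ 2 by rewrite ler_pXn2r ?nnegrE ?sqrtr_ge0 ?UC.
rewrite sqr_sqrtr ?addr_ge0 ?hdot_ge0// /sum_dot.
rewrite /trial !indef_dotE /= angular0 !hdot0l.
have := hdot_ge0 n.1; have := hdot_ge0 (w j - n.2).
rewrite !hdotE (hdotC n.2); lra.
Qed.

End DualPair.

Theorem corollary5p2 (R : realType) (k : nat) (H K : hilbertType R)
    (Hdim : infinite_dim H) (Kdim : has_dim K k)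
    (G : set (H * K -> H * K)) (Ggroup : operator_group G)
    (GJ : forall U, G U -> J_unitary U) (Gbounded : bounded_family G) :
  exists M N : set (H * K),
    [/\ dual_pair M N, invariant_under G M & invariant_under G N].
Proof.
have [m [e [eP eS]]] := orthonormal_basis Kdim.
have [c Gc] := energy_bound0 eP Gbounded.
have [a nega inva] := invariant_graph eP eS Ggroup GJ Gc.
exists (indef_orthogonal (range (graph e a))), (range (graph e a)); split=> //.
  exact: dual_pair_graph.
exact: invariant_indef_orthogonal.
Qed.
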